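(* Let $k$ be a positive integer and let $G$ be a finite simple $2$-regular graph, having at least one vertex, such that $k$ is at most the largest diameter of a connected component of $G$. Then $G$ is $\{k\}$-distance magic if and only if $G$ is a disjoint union of (one or more) cycles $C_{4k}$.
   Context: $C_n$ denotes the cycle on $n\ge 3$ vertices. Let $G=(V,E)$ be a finite simple undirected graph with $v=|V|$ vertices, and let $d(x,y)$ be the graph distance (vertices in different connected components are at infinite distance). For a set $D$ of nonnegative integers and $x\in V$, put $N_D(x)=\{y\in V : d(x,y)\in D\}$. A $D$-distance magic labeling of $G$ is a bijection $f:V\to\{1,2,\ldots,v\}$ for which there is a constant $\mathsf{k}$ such that $\sum_{y\in N_D(x)} f(y)=\mathsf{k}$ for every $x\in V$. $G$ is called $D$-distance magic if it admits a $D$-distance magic labeling. *)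

(* Defs.v *)
From HB Require Import structures.
From mathcomp Require Import all_boot.

Set Implicit Arguments.
Unset Strict Implicit.
Unset Printing Implicit Defensive.

Record sgraph := SGraph {
  vertex :> finType;
  adj : rel vertex;
  adj_sym : symmetric adj;
  adj_irrefl : irreflexive adj }.

Definition regular (r : nat) (G : sgraph) : Prop :=
  forall x : G, #|[set y | adj x y]| = r.

Definition isomorphic (G H : sgraph) : Prop :=
  exists phi : G -> H, bijective phi /\ forall x y, adj (phi x) (phi y) = adj x y.

Section Distance.
Variable G : sgraph.

Definition walk (n : nat) (x y : G) : bool :=
  [exists p : n.-tuple G, path (@adj G) x p && (last x p == y)].

(* None is infinite distance. A shortest walk visits each vertex at most once,
   so it has fewer than #|G| edges and the search always succeeds; the index
   returned by find in iota 0 _ is the length itself. *)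
Definition dist (x y : G) : option nat :=
  if connect (@adj G) x y
  then Some (find (fun n => walk n x y) (iota 0 #|G|))
  else None.

Definition components : {set {set G}} :=
  equivalence_partition (connect (@adj G)) [set: G].

(* Only applied to connected components: there every distance is finite, so
   the default is not used, and a shortest path of G between two vertices of C
   stays in C. *)
Definition diameter (C : {set G}) : nat :=
  \max_(x in C) \max_(y in C) odflt 0 (dist x y).

Definition max_component_diameter : nat := \max_(C in components) diameter C.

Definition dist_neighbourhood (D : pred nat) (x : G) : {set G} :=
  [set y | if dist x y is Some n then n \in D else false].

(* f is a bijection from the vertices onto {1, ..., #|G|}. *)
Definition is_labeling (f : G -> nat) : Prop :=
  injective f /\ forall m, (exists x, f x = m) <-> 1 <= m <= #|G|.

Definition is_distance_magic_labeling (D : pred nat) (f : G -> nat) : Prop :=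
  is_labeling f /\
  exists c, forall x, \sum_(y in dist_neighbourhood D x) f y = c.

End Distance.

Definition distance_magic (D : pred nat) (G : sgraph) : Prop :=
  exists f : G -> nat, is_distance_magic_labeling D f.

Section Cycle.
Variable n : nat.

(* The conjunct i != j is redundant for n >= 2; it makes the definition total. *)
Definition cycle_adj : rel 'I_n := fun i j =>
  (i != j) && ((j == i.+1 %% n :> nat) || (i == j.+1 %% n :> nat)).

Lemma cycle_adj_sym : symmetric cycle_adj.
Proof. by move=> i j; rewrite /cycle_adj eq_sym orbC. Qed.

Lemma cycle_adj_irrefl : irreflexive cycle_adj.
Proof. by move=> i; rewrite /cycle_adj eqxx. Qed.

(* This is the n-cycle C_n when n >= 3. *)
Definition cycle_graph : sgraph := SGraph cycle_adj_sym cycle_adj_irrefl.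

End Cycle.

Section Copies.
Variables (m : nat) (H : sgraph).

Definition copies_adj : rel ('I_m * H) := fun u v =>
  (u.1 == v.1) && adj u.2 v.2.

Lemma copies_adj_sym : symmetric copies_adj.
Proof. by move=> u v; rewrite /copies_adj eq_sym adj_sym. Qed.

Lemma copies_adj_irrefl : irreflexive copies_adj.
Proof. by move=> u; rewrite /copies_adj adj_irrefl andbF. Qed.

Definition disjoint_copies : sgraph := SGraph copies_adj_sym copies_adj_irrefl.

End Copies.

(* Main.v *)
Require Import Defs.
From mathcomp Require Import all_boot.
From mathcomp Require Import zify.

Set Implicit Arguments.
Unset Strict Implicit.
Unset Printing Implicit Defensive.

(** A 2-regular graph is a disjoint union of cycles. Turning every cycle in one
    of its two senses gives an injection [s] with [adj x y] iff [y = s x] or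
    [x = s y] ([orientation_exists]); the cycle through [x] is then the orbit of
    [x], its length is [order s x], and the theorem becomes a statement about
    the powers of [s].

    Going [a] steps forward and [b] steps back is never shortest when both are
    positive, so a vertex at distance [k] from [x] is [s^k x] or [s^-k x], and
    the distance is [k] iff the cycle has length at least [2k]
    ([orientation_distP]). Centring the sphere at [s^k x] avoids inverses: it is
    [{x, s^2k x}] or empty ([sphere_iter]).

    Let [f] be a magic labeling with constant [c]. Labels are positive, and
    some cycle has length at least [2k], so [c > 0] and no sphere is empty: all
    cycles have length at least [2k]. On a cycle of length exactly [2k] spheres
    are singletons and [f] would be constant. On longer cycles
    [f x + f (s^2k x) = c] for all [x]; applied to [x] and to [s^2k x] this
    gives [f x = f (s^4k x)], so the length divides [4k], and being larger than
    [2k] it is [4k] ([magic_order]).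

    Conversely, if all cycles have length [4k], the map [s^2k] is a fixed-point
    free involution, and giving the labels [i] and [v + 1 - i] to the two points
    of each of its orbits makes all sphere sums [v + 1]
    ([antipodal_labeling]).

    Finally, being a union of cycles [C_n] is the same as having an orientation
    whose orbits all have size [n] ([orientation_of_copies],
    [copies_of_orientation]). *)

(** * Distance and shortest walks *)

Section Walks.
Variable G : sgraph.
Implicit Types x y z : G.

Lemma walkP n x y :
  reflect (exists p : seq G, [/\ path (@adj G) x p, last x p = y & size p = n])
          (walk n x y).
Proof.
apply: (iffP existsP) => [[p /andP[xp /eqP py]] | [p [xp py /eqP szp]]].
  by exists p; rewrite size_tuple.
by exists (Tuple szp); rewrite /= xp py eqxx.
Qed.

Lemma walk0 x y : walk 0 x y = (x == y).
Proof.
apply/walkP/eqP => [[p [_ <- /size0nil->]] // | <-].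
by exists [::].
Qed.

Lemma walkS n x y :
  reflect (exists2 z, adj x z & walk n z y) (walk n.+1 x y).
Proof.
apply: (iffP (@walkP _ _ _)) => [[[|z p] []] //= | [z xz]].
  case/andP=> xz zp py [szp].
  by exists z => //; apply/walkP; exists p.
by case/walkP=> p [zp py szp]; exists (z :: p); rewrite /= xz szp.
Qed.

Lemma walk_sym n x y : walk n x y = walk n y x.
Proof.
suff sub (u v : G) : walk n u v -> walk n v u by apply/idP/idP; apply: sub.
case/walkP=> p [up <- szp]; apply/walkP; exists (rev (belast u p)); split.
- by rewrite rev_path; apply: sub_path up => a b; rewrite adj_sym.
- by case: p {up szp} => //= z p; rewrite rev_cons last_rcons.
by rewrite size_rev size_belast.
Qed.

Lemma walk_shorten n x y :
  walk n x y -> exists2 m, m < #|G| & walk m x y.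
Proof.
case/walkP=> p [xp <- _]; case/shortenP: xp => q xq uq _.
exists (size q); last by apply/walkP; exists q.
by rewrite -[(size q).+1]/(size (x :: q)) -(card_uniqP uq) max_card.
Qed.

(** The search that defines [dist] stops below [#|G|], and [walk_shorten] shows
    that this bound excludes no connected pair. *)
Lemma dist_SomeP x y n :
  dist x y = Some n <-> walk n x y /\ forall i, i < n -> ~~ walk i x y.
Proof.
rewrite /dist; set a := fun i => walk i x y.
have findP i : walk i x y ->
    find a (iota 0 #|G|) < #|G| /\ walk (find a (iota 0 #|G|)) x y.
  case/walk_shorten=> j ltj wj.
  have hasw: has a (iota 0 #|G|) by apply/hasP; exists j; rewrite ?mem_iota.
  have := hasw; rewrite has_find size_iota => ltG.
  by have := nth_find 0 hasw; rewrite nth_iota.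
have find_min i : i < find a (iota 0 #|G|) -> i < #|G| -> ~~ walk i x y.
  by move=> lti ltG; have := before_find 0 lti; rewrite nth_iota // => /negbT.
split=> [|[wn min_n]].
  case: ifP => // /connectP[p xp py] [<-].
  have /findP[ltG wf] : walk (size p) x y by apply/walkP; exists p.
  by split=> // i lti; apply: find_min => //; apply: ltn_trans ltG.
have -> : connect (@adj G) x y.
  by have /walkP[p [xp py _]] := wn; apply/connectP; exists p.
have [ltG wf] := findP _ wn; congr Some; apply/eqP; rewrite eqn_leq.
apply/andP; split; rewrite leqNgt; apply/negP => lt.
  by have := find_min _ lt (ltn_trans lt ltG); rewrite wn.
by have := min_n _ lt; rewrite wf.
Qed.

Lemma dist_sym x y : dist x y = dist y x.
Proof.
have sub (u v : G) n : dist u v = Some n -> dist v u = Some n.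
  case/dist_SomeP=> wn min_n; apply/dist_SomeP; rewrite walk_sym.
  by split=> // i; rewrite walk_sym; apply: min_n.
case E: (dist x y) => [n|]; first by rewrite (sub _ _ _ E).
by case E': (dist y x) => [n|//]; rewrite (sub _ _ _ E') in E.
Qed.

Lemma max_component_diameter_leq n :
    (forall x y d, dist x y = Some d -> d <= n) ->
  max_component_diameter G <= n.
Proof.
move=> le_n; apply/bigmax_leqP => C _; apply/bigmax_leqP => x _.
apply/bigmax_leqP => y _.
by case E: (dist x y) => [d|] //=; apply: le_n E.
Qed.

End Walks.

(** * Iterates of an injection of a finite type *)

Section InjectiveIteration.
Variables (T : finType) (s : T -> T).
Hypothesis s_inj : injective s.

Lemma iter_inj n : injective (iter n s).
Proof. by elim: n => [|n IHn] x y //= /s_inj/IHn. Qed.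

Lemma iter_mod_order n x : iter (n %% order s x) s x = iter n s x.
Proof.
rewrite {2}(divn_eq n (order s x)) addnC iterD; congr iter.
elim: (n %/ _) => [|q IHq] //.
by rewrite mulSn iterD -IHq iter_order.
Qed.

Lemma eq_iter_mod a b x :
  (iter a s x == iter b s x) = (a == b %[mod order s x]).
Proof.
apply/eqP/eqP => [|eq_ab]; last by rewrite -iter_mod_order eq_ab iter_mod_order.
rewrite -(iter_mod_order a) -(iter_mod_order b) => /(congr1 (findex s x)).
by rewrite !findex_iter ?ltn_mod ?order_gt0.
Qed.

Lemma order_iter n x : order s (iter n s x) = order s x.
Proof.
elim: n => //= n <-.
apply: eq_card => y; rewrite !inE.
by symmetry; apply: (same_connect (fconnect_sym s_inj)); apply: fconnect1.
Qed.

Lemma order_unique n x :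
    0 < n -> iter n s x = x -> (forall i, 0 < i < n -> iter i s x <> x) ->
  order s x = n.
Proof.
move=> n_gt0 /eqP xn min_n; have o_gt0 := order_gt0 s x.
have dvd_on: order s x %| n.
  by move: xn; rewrite -[X in _ == X]/(iter 0 s x) eq_iter_mod mod0n.
apply/eqP; rewrite eqn_leq dvdn_leq //= leqNgt; apply/negP => lt_on.
by apply: (min_n (order s x)); rewrite ?o_gt0 ?iter_order.
Qed.

End InjectiveIteration.

(** * Distance in an oriented union of cycles *)

(** [s] turns every cycle of [G] by one step. An [s] that swaps the two ends of
    an isolated edge is allowed as well: the distance computation holds for it
    unchanged. *)
Definition orientation (G : sgraph) (s : G -> G) : Prop :=
  injective s /\ forall x y, adj x y = (y == s x) || (x == s y).

Section Orientation.
Variables (G : sgraph) (s : G -> G).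
Hypothesis or_s : orientation s.
Let s_inj : injective s := proj1 or_s.
Let adjE := proj2 or_s.

Lemma orientation_neq x : s x <> x.
Proof. by move=> sx; have := adjE x x; rewrite adj_irrefl sx eqxx. Qed.

(** Forward and backward steps commute, so only their numbers matter. Writing
    the condition as [iter a s x = iter b s y] avoids the inverse of [s]. *)
Lemma orientation_walkP n x y :
  walk n x y <-> exists a b, a + b = n /\ iter a s x = iter b s y.
Proof.
elim: n x => [|n IHn] x.
  rewrite walk0; split => [/eqP-> | [[|a] [[|b] [//= _ ->]]] //].
  by exists 0, 0.
split.
  case/walkS=> z; rewrite adjE => xz /IHn[a [b [<- ab]]].
  case/orP: xz => /eqP => [zx | xz].
    by exists a.+1, b; split; rewrite // iterSr -zx.
  by exists a, b.+1; split; rewrite ?addnS // xz -iterSr /= ab.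
case=> [[|a] [b [ab]]] => [/= xb|]; last first.
  rewrite iterSr => ayb; apply/walkS; exists (s x); first by rewrite adjE eqxx.
  by apply/IHn; exists a, b; split=> //; case: ab.
case: b ab xb => // b [bn] /= xb; apply/walkS; exists (iter b s y).
  by rewrite adjE xb eqxx orbT.
by apply/IHn; exists 0, b.
Qed.

Lemma orientation_dist_forward k x :
  k.*2 <= order s x -> dist x (iter k s x) = Some k.
Proof.
move=> le2k; apply/dist_SomeP; split.
  by apply/orientation_walkP; exists k, 0; rewrite addn0.
move=> i lt_ik; apply/negP => /orientation_walkP[a [b [abi]]].
rewrite -iterD => /eqP; rewrite eq_iter_mod // !modn_small; lia.
Qed.

(** Going forward more than half of the way round is beaten by going backward. *)
Lemma shortest_forward_half_order k x :
  (forall i, i < k -> ~~ walk i x (iter k s x)) -> k.*2 <= order s x.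
Proof.
move=> mink; have o_gt0 := order_gt0 s x; rewrite leqNgt; apply/negP => ltk.
case: (leqP k (order s x)) => [le_k | gt_k].
  have/mink/negP[]: order s x - k < k by lia.
  apply/orientation_walkP; exists 0, (order s x - k); split=> //.
  by rewrite -iterD subnK // iter_order.
have/mink/negP[]: k - order s x < k by lia.
apply/orientation_walkP; exists (k - order s x), 0; split; first by rewrite addn0.
by rewrite -[in RHS](subnK (ltnW gt_k)) /= iterD iter_order.
Qed.

(** In a shortest walk all steps have the same sense, since a forward and a
    backward step would cancel. *)
Lemma orientation_distP k x y :
  dist x y = Some k <->
  k.*2 <= order s x /\ (y = iter k s x \/ x = iter k s y).
Proof.
split; last first.
  case=> le2k [->|xy]; first exact: orientation_dist_forward.
  rewrite dist_sym xy; apply: orientation_dist_forward.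
  by rewrite xy order_iter in le2k.
move=> dk; have := dk; rewrite dist_sym => /dist_SomeP[_ mink'].
case/dist_SomeP: dk => /orientation_walkP[a [b [abk ab]]] mink.
case: a abk ab => [|a] abk ab.
  (* all steps backward: the walk from y to x goes forward *)
  have xy: x = iter k s y by rewrite -abk.
  split; last by right.
  rewrite xy order_iter //; apply: shortest_forward_half_order => i.
  by rewrite -xy; apply: mink'.
case: b abk ab => [|b] abk ab.
  have yx: y = iter k s x by rewrite -abk addn0 ab.
  split; last by left.
  by apply: shortest_forward_half_order => i; rewrite -yx; apply: mink.
(* one forward and one backward step cancel *)
have/mink/negP[]: a + b < k by lia.
by apply/orientation_walkP; exists a, b; split=> //; apply: s_inj.
Qed.

Lemma sphere_iter k x :
  dist_neighbourhood (pred1 k) (iter k s x) =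
  if k.*2 <= order s x then [set x; iter k.*2 s x] else set0.
Proof.
apply/setP => y; rewrite inE.
have -> : (if dist (iter k s x) y is Some n then n \in pred1 k else false)
        = (dist (iter k s x) y == Some k).
  by case: dist => //= n; rewrite inE.
apply/eqP/idP => [/orientation_distP[] | ].
  rewrite order_iter // => -> [->|/iter_inj<- //]; rewrite !inE ?eqxx //.
  by rewrite -iterD addnn eqxx orbT.
case: ifP => [le2k | _]; last by rewrite inE.
rewrite !inE => yE; apply/orientation_distP; rewrite order_iter //; split=> //.
by case/orP: yE => /eqP->; [right | left; rewrite -iterD addnn].
Qed.

(** The case [order s x = 2k] is separate because there [x] and [s^2k x]
    coincide and the label is counted once. *)
Lemma sphere_sum k (f : G -> nat) x : 0 < k ->
  \sum_(y in dist_neighbourhood (pred1 k) (iter k s x)) f y =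
  if order s x < k.*2 then 0
  else if order s x == k.*2 then f x else f x + f (iter k.*2 s x).
Proof.
move=> k_gt0; rewrite sphere_iter leqNgt.
case: ltnP => [_ | le2k] /=; first by rewrite big_set0.
have := eq_iter_mod s_inj k.*2 0 x; rewrite mod0n /=.
have [ok | nok] := eqVneq (order s x) k.*2.
  by rewrite -ok modnn eqxx => /eqP->; rewrite setUid big_set1.
rewrite modn_small; last by rewrite ltn_neqAle eq_sym nok.
rewrite double_eq0 eqn0Ngt k_gt0 => /= x2k.
by rewrite big_setU1 ?big_set1 // inE eq_sym x2k.
Qed.

Lemma exists_long_orbit k :
  0 < k <= max_component_diameter G -> exists x, k.*2 <= order s x.
Proof.
case/andP=> k_gt0 lek; apply/existsP; apply: contraT.
rewrite negb_exists => /forallP shortG.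
suff: max_component_diameter G <= k.-1 by lia.
apply: max_component_diameter_leq => x y d /orientation_distP[le2d _].
have := shortG x; lia.
Qed.

(** * Magic labelings *)

(** A sphere sum is [0], a single label or [f x + f (s^2k x)]; only the last is
    compatible with a positive constant sum and an injective [f], and it forces
    [s^4k] to be the identity. *)
Lemma magic_order k :
    0 < k <= max_component_diameter G -> distance_magic (pred1 k) G ->
  forall x, order s x = 4 * k.
Proof.
move=> k_bnd [f [[f_inj f_lab] [c fc]]].
have [k_gt0 _] := andP k_bnd.
have sumE x := etrans (esym (sphere_sum f x k_gt0)) (fc _).
have f_gt0 x : 0 < f x.
  by have /f_lab/andP[] : exists y, f y = f x by exists x.
have c_gt0: 0 < c.
  have [x le2k] := exists_long_orbit k_bnd.
  rewrite -(sumE x) (ltnNge (order s x)) le2k /=; case: ifP => _ //.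
  exact: ltn_addr.
have gt2k x : k.*2 < order s x.
  have := sumE x; case: ltngtP => // [_ c0 | oxk fx].
    by rewrite -c0 in c_gt0.
  have := sumE (s x); rewrite (order_iter s_inj 1) oxk ltnn eqxx -fx.
  by move/f_inj/orientation_neq.
have antipode x : f x + f (iter k.*2 s x) = c.
  by rewrite -(sumE x); case: ltngtP (gt2k x).
move=> x; have := antipode x; rewrite -(antipode (iter k.*2 s x)) addnC.
move/addnI/f_inj/esym/eqP; rewrite -iterD.
rewrite -[X in _ == X]/(iter 0 s x) eq_iter_mod // mod0n => /dvdnP[q oq].
(* 4k = q * order with order > 2k leaves only q = 1 *)
have := gt2k x; have: 0 < q by lia.
by case: q oq => [|[|q]] oq _ ltk; nia.
Qed.

End Orientation.

Lemma labeling_of_injection (G : sgraph) (f : G -> nat) :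
  injective f -> (forall x, 1 <= f x <= #|G|) -> is_labeling f.
Proof.
move=> f_inj f_bnd; split=> // m.
have sub: {subset codom f <= iota 1 #|G|}.
  by move=> _ /codomP[x ->]; rewrite mem_iota add1n ltnS.
have uf: uniq (codom f) by rewrite map_inj_uniq ?enum_uniq.
have [|_ codE] := uniq_min_size uf sub; first by rewrite size_iota size_codom.
have -> : (1 <= m <= #|G|) = (m \in iota 1 #|G|) by rewrite mem_iota add1n ltnS.
rewrite -codE.
by split=> [[x <-] | /codomP[x ->]]; [apply: codom_f | exists x].
Qed.

(** [A] contains one point of each orbit [{x, t x}], the one enumerated first.
    The points of [A] get the labels [1, ..., #|A|], and [t x] gets the
    complement to [#|G|.+1] of the label of [x]; no label is used twice because
    [A] is exactly half of [G]. *)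
Lemma antipodal_labeling (G : sgraph) (t : G -> G) :
    involutive t -> (forall x, t x <> x) ->
  exists2 f : G -> nat, is_labeling f & forall x, f x + f (t x) = #|G|.+1.
Proof.
move=> tK t_neq.
pose A := [set x : G | enum_rank x < enum_rank (t x)].
have At x : (t x \in A) = (x \notin A).
  rewrite !inE tK -leqNgt [in RHS]leq_eqVlt orb_idl // => /eqP/val_inj/enum_rank_inj.
  by move/t_neq.
have cardA: #|A| + #|A| = #|G|.
  rewrite -{1}(card_imset A (inv_inj tK)) -(cardsC A) addnC.
  congr (_ + _); apply: eq_card => x; rewrite inE -At.
  by apply/imsetP/idP => [[y Ay ->] | Atx]; [rewrite tK | exists (t x); rewrite ?tK].
pose g x := (index x (enum A)).+1.
have g_lt x : x \in A -> g x <= #|A|.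
  by move=> Ax; rewrite /g cardE index_mem mem_enum.
have g_inj x y : x \in A -> y \in A -> g x = g y -> x = y.
  move=> Ax Ay [] /(congr1 (nth x (enum A))).
  by rewrite !nth_index ?mem_enum.
pose f x := if x \in A then g x else #|G|.+1 - g (t x).
have f_bnd x : 1 <= f x <= #|G|.
  rewrite /f; case: ifP => [/g_lt | /negbT]; last rewrite -At => /g_lt;
  by rewrite -cardA /g; lia.
have f_inj : injective f.
  move=> x y; rewrite /f.
  case: ifP => [Ax|/negbT]; [|rewrite -At => Ax];
  case: ifP => [Ay|/negbT]; try rewrite -At => Ay.
  - exact: g_inj.
  - by have := g_lt _ Ax; have := g_lt _ Ay; rewrite -cardA /g; lia.
  - by have := g_lt _ Ax; have := g_lt _ Ay; rewrite -cardA /g; lia.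
  move=> eg; apply: (inv_inj tK); apply: g_inj => //.
  by have := g_lt _ Ax; have := g_lt _ Ay; move: eg; rewrite -cardA; lia.
exists f; first exact: labeling_of_injection.
move=> x; have := f_bnd x; rewrite /f At tK.
by case: (boolP (x \in A)) => /= Ax; have := g_lt; lia.
Qed.

(** * Orienting a 2-regular graph *)

Lemma first_repetition (T : finType) (u : nat -> T) :
  exists2 n, (exists2 j, j < n & u j = u n) &
             forall i j, i < j < n -> u i != u j.
Proof.
pose rep n := [exists j : 'I_n, u j == u n].
have repP n : reflect (exists2 j, j < n & u j = u n) (rep n).
  apply: (iffP existsP) => [[j /eqP ujn] | [j ltjn ujn]]; first by exists j.
  by exists (Ordinal ltjn); rewrite /= ujn.
have ex_rep: exists n, rep n.
  have: ~~ injectiveb (fun i : 'I_#|T|.+1 => u i).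
    by apply/injectiveP => /leq_card; rewrite card_ord ltnn.
  case/injectivePn=> i [j neq_ij uij].
  wlog lt_ij : i j neq_ij uij / i < j => [IH|].
    have [lt|lt|/val_inj eq_ij] := ltngtP i j; first exact: (IH i j).
      by apply: (IH j i) => //; rewrite eq_sym.
    by rewrite eq_ij eqxx in neq_ij.
  by exists j; apply/repP; exists i.
case: (ex_minnP ex_rep) => n /repP rep_n min_n; exists n => // i j /andP[ltij ltjn].
by apply: contraTneq ltjn => uij; rewrite -leqNgt min_n //; apply/repP; exists i.
Qed.

Section TwoRegular.
Variable G : sgraph.
Hypothesis regG : regular 2 G.

Lemma two_neighbours (x y z : G) :
  adj x y -> adj x z -> y != z -> forall w, adj x w = (w == y) || (w == z).
Proof.
move=> xy xz neq_yz w; have /eqP := regG x; case/cards2P=> a [b [_ Nab]].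
have {}Nab v : adj x v = (v == a) || (v == b).
  by have /setP/(_ v) := Nab; rewrite !inE.
move: xy xz neq_yz; rewrite !Nab.
by do 2![case/orP=> /eqP->]; rewrite ?eqxx // orbC.
Qed.

Lemma neighbour (x : G) : exists y, adj x y.
Proof.
have /eqP/cards2P[a [b [_ /setP/(_ a)]]] := regG x.
by rewrite !inE eqxx => xa; exists a.
Qed.

Lemma other_neighbour (y x : G) : exists2 z, adj y z & z != x.
Proof.
have /eqP/cards2P[a [b [neq_ab /setP Nab]]] := regG y.
have := Nab a; have := Nab b; rewrite !inE !eqxx orbT => yb ya.
have [xa|] := eqVneq a x; last by exists a.
by exists b; rewrite // -xa eq_sym.
Qed.

(** Walk on from [x], always leaving a vertex by the neighbour other than the
    one used to arrive, until a vertex [u n] repeats an earlier [u j]. If [j > 0],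
    both neighbours of [u j] are already on the walk, next to it, so [u n.-1],
    which is adjacent to [u n = u j], would give an earlier
    repetition, a backtracking step or a loop. Hence [j = 0] and the walk has closed up. *)
Lemma cycle_through (x : G) :
  exists c : seq G, [&& x \in c, uniq c, cycle (@adj G) c & 2 < size c].
Proof.
have [other otherP] : exists other : G * G -> G,
    forall p, adj p.2 (other p) && (other p != p.1).
  have ex (p : G * G) : exists z, adj p.2 z && (z != p.1).
    by have [z pz zp] := other_neighbour p.2 p.1; exists z; rewrite pz.
  exact: fin_all_exists ex.
have [y xy] := neighbour x.
(* w i is the pair of the vertices number i and i.+1 of the walk *)
pose w i := iter i (fun p => (p.2, other p)) (x, y).
pose u i := (w i).1.
have adj_u i : adj (u i) (u i.+1).
  case: i => [|i]; first exact: xy.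
  by have /andP[] := otherP (w i).
have u_neq i : u i.+2 != u i by have /andP[] := otherP (w i).
have [n [j ltjn ujn] u_uniq] := first_repetition u.
have adj_back i z : adj (u i.+1) z -> (z == u i.+2) || (z == u i).
  by rewrite (two_neighbours (adj_u i.+1) _ (u_neq i)) // adj_sym.
have j0: j = 0.
  case: j ltjn ujn => // j ltjn ujn; case: n => // n in ltjn ujn u_uniq *.
  have := adj_u n; rewrite -ujn adj_sym => /adj_back/orP[] /eqP unj.
    have [lt|lt|eq_n] := ltngtP n j.+2.
    - by have := adj_u n; rewrite -ujn (_ : n = j.+1) ?adj_irrefl //; lia.
    - by have := u_uniq j.+2 n; rewrite lt ltnSn unj eqxx => /(_ isT).
    - by have := u_neq j.+1; rewrite -eq_n ujn eqxx.
  by have := u_uniq j n; rewrite unj eqxx ltnSn -ltnS ltjn => /(_ isT).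
rewrite {j}j0 in ltjn ujn.
have gt2n: 2 < n.
  case: n => [|[|[|n]]] // in ltjn ujn u_uniq *.
    by have := adj_u 0; rewrite -ujn adj_irrefl.
  by have := u_neq 0; rewrite -ujn eqxx.
exists (mkseq u n); rewrite size_mkseq gt2n andbT; apply/and3P; split.
- by apply/mapP; exists 0; rewrite // mem_iota.
- apply/(uniqP x) => a b; rewrite !inE size_mkseq => ltan ltbn.
  rewrite !nth_mkseq // => uab.
  have [lt|lt|//] := ltngtP a b.
    by have := u_uniq a b; rewrite lt ltbn uab eqxx => /(_ isT).
  by have := u_uniq b a; rewrite lt ltan uab eqxx => /(_ isT).
case: n => // n in ltjn ujn u_uniq gt2n *.
have -> : cycle (@adj G) (mkseq u n.+1)
        = path (@adj G) (u 0) (rcons (mkseq (u \o succn) n) (u 0)).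
  by rewrite /mkseq /= (iotaDl 1 0) -map_comp.
apply/(pathP x) => i; rewrite size_rcons size_mkseq => lti.
have nthE m : m <= n.+1 ->
    nth x (u 0 :: rcons (mkseq (u \o succn) n) (u 0)) m = u m.
  case: m => // m; rewrite /= ltnS => lem; rewrite nth_rcons size_mkseq.
  case: ltngtP lem => // [lt _|-> _]; first by rewrite nth_mkseq.
  exact: ujn.
by have := nthE i.+1 lti; have := nthE i (ltnW lti) => /= -> ->.
Qed.

(** In a cycle of length at least 3 the successor and the predecessor of [x]
    differ, so they are all the neighbours of [x]. *)
Lemma cycle_neighbours (c : seq G) (x y : G) :
    uniq c -> cycle (@adj G) c -> 2 < size c -> x \in c ->
  adj x y = (y == next c x) || (y == prev c x).
Proof.
move=> uc cc gt2 xc; apply: two_neighbours.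
- exact: next_cycle.
- by rewrite adj_sym; apply: prev_cycle.
apply/eqP => np.
have := order_cycle (cycle_next uc) uc xc.
suff: order (next c) x <= 2 by lia.
have: order (next c) x %| 2.
  have n_inj : injective (next c) := can_inj (prev_next uc).
  have := eq_iter_mod n_inj 2 0 x; rewrite mod0n /dvdn => <-.
  by rewrite /= np next_prev.
by move/dvdn_leq->.
Qed.

(** One cycle must be fixed for each component, because cycles found from
    different vertices of a component may run in opposite senses: the cycle of
    the representative [root (@adj G) x] serves for all of the component. It
    covers the component, being closed under adjacency. *)
Lemma orientation_exists : exists s : G -> G, orientation s.
Proof.
have [cyc cycP] := fin_all_exists cycle_through.
have symG : connect_sym (@adj G).
  by apply: sym_connect_sym; apply: adj_sym.
pose c x := cyc (root (@adj G) x).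
have cP x : [/\ uniq (c x), cycle (@adj G) (c x) & 2 < size (c x)].
  by have /and4P[] := cycP (root (@adj G) x).
have c_adj x y : adj x y -> c x = c y.
  by move/connect1/(rootP symG); rewrite /c => ->.
have mem_c x : x \in c x.
  have [uc cc sc] := cP x; have /and4P[rc _ _ _] := cycP (root (@adj G) x).
  have clo a b : adj a b -> a \in c x -> b \in c x.
    move=> ab ac; move: ab; rewrite (cycle_neighbours _ uc cc sc ac).
    by case/orP=> /eqP->; rewrite ?mem_next ?mem_prev.
  have closed_c : closed (@adj G) (mem (c x)).
    by move=> a b ab; apply/idP/idP; apply: clo; rewrite // adj_sym.
  by have := closed_connect closed_c (connect_root _ x) => ->.
have adjE x y : adj x y = (y == next (c x) x) || (y == prev (c x) x).
  by have [uc cc sc] := cP x; apply: cycle_neighbours.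
exists (fun x => next (c x) x); split=> [x y nxy | x y].
  have cxy: c x = c y.
    rewrite (c_adj x (next (c x) x)) ?adjE ?eqxx // nxy.
    by rewrite -(c_adj y) // adjE eqxx.
  have [uc _ _] := cP x; apply: (can_inj (prev_next uc)).
  by rewrite /= nxy cxy.
have [uc _ _] := cP x; rewrite adjE; congr (_ || _).
apply/eqP/eqP => [yE | xE].
  have -> : c y = c x by apply/esym/c_adj; rewrite adjE yE eqxx orbT.
  by rewrite yE next_prev.
have -> : c x = c y by apply/esym/c_adj; rewrite adjE -xE eqxx.
by rewrite {1}xE prev_next //; case: (cP y).
Qed.

End TwoRegular.

(** * Unions of cycles of equal length *)

Section CopiesOfCycles.
Variable n : nat.
Hypothesis n_gt1 : 1 < n.

Lemma copies_adjE m (u v : disjoint_copies m (cycle_graph n)) :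
  adj u v = (v == (u.1, ordS u.2)) || (u == (v.1, ordS v.2)).
Proof.
have ordS_neq (i : 'I_n) : ordS i != i.
  apply/eqP => /(congr1 val) /=; have := ltn_ord i.
  rewrite leq_eqVlt => /orP[/eqP E | lt]; last by rewrite modn_small //; lia.
  by rewrite E modnn; lia.
case: u v => [a i] [b j]; rewrite /= /copies_adj /= /cycle_adj !xpair_eqE (eq_sym b a).
rewrite -andb_orr -!(inj_eq val_inj) /=; congr (_ && _); rewrite andb_idl //.
case/orP=> /eqP E; apply/eqP => eq_ij.
  by have /eqP[] := ordS_neq i; apply: val_inj; rewrite /= -E eq_ij.
by have /eqP[] := ordS_neq j; apply: val_inj; rewrite /= -E eq_ij.
Qed.

(** The rotation [i |-> i + 1] of each copy, carried over to [G]. *)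
Lemma orientation_of_copies m (G : sgraph) :
    isomorphic G (disjoint_copies m (cycle_graph n)) ->
  exists2 s : G -> G, orientation s & forall x, order s x = n.
Proof.
set H := disjoint_copies _ _.
case=> phi [[psi phiK psiK] phi_adj].
pose r (u : H) : H := (u.1, ordS u.2).
have r_inj : injective r.
  move=> [a i] [b j] eq_r.
  by congr (_, _); [exact: (congr1 fst eq_r) | exact: ordS_inj (congr1 snd eq_r)].
pose s x := psi (r (phi x)).
have or_s : orientation s.
  split=> [x y /(can_inj psiK)/r_inj/(can_inj phiK) // | x y].
  by rewrite -phi_adj copies_adjE /s -!(can2_eq phiK psiK).
exists s => // x.
have phi_iter a : phi (iter a s x) = iter a r (phi x).
  by elim: a => //= a <-; rewrite psiK.
have r1 a u : (iter a r u).1 = u.1 by elim: a.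
have r2 a u : (iter a r u).2 = (u.2 + a) %% n :> nat.
  elim: a => [|a IHa] /=; first by rewrite addn0 modn_small.
  by rewrite IHa -addn1 modnDml addn1 addnS.
have n_gt0 := ltnW n_gt1.
apply: (order_unique (proj1 or_s)) => [//|| i /andP[i_gt0 ltin]].
  apply: (can_inj phiK); rewrite phi_iter.
  rewrite [LHS]surjective_pairing [RHS]surjective_pairing r1.
  by congr (_, _); apply: val_inj; rewrite /= r2 modnDr modn_small.
move=> /(congr1 phi); rewrite phi_iter => /(congr1 (fun u : H => u.2 : nat)) /=.
rewrite r2 -[RHS](@modn_small _ n) // -[X in _ = X %% _]addn0 => /eqP.
by rewrite eqn_modDl mod0n modn_small // eqn0Ngt i_gt0.
Qed.

(** Each orbit is measured from its representative in [froots s]: the pair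
    [(a, i)] stands for the vertex [i] steps after representative number [a]. *)
Lemma copies_of_orientation (G : sgraph) (s : G -> G) :
    orientation s -> (forall x, order s x = n) ->
  isomorphic G (disjoint_copies #|froots s| (cycle_graph n)).
Proof.
move=> or_s os; have s_inj := proj1 or_s.
pose K := disjoint_copies #|froots s| (cycle_graph n).
pose psi (u : K) : G := iter u.2 s (enum_val u.1).
have root_psi u : froot s (psi u) = enum_val u.1.
  have /eqP <- := enum_valP u.1.
  by apply/esym/(rootP (fconnect_sym s_inj)); apply: fconnect_iter.
have psi_inj : injective psi.
  move=> [a i] [b j] eq_psi.
  have := root_psi (a, i); rewrite eq_psi root_psi /= => /enum_val_inj eq_ab.
  move: eq_psi; rewrite /psi /= eq_ab => /eqP.
  rewrite eq_iter_mod // os !modn_small // => /eqP eq_ij.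
  by congr (_, _); apply: val_inj.
have psi_surj x : exists u, psi u = x.
  have rx : froot s x \in froots s := roots_root (fconnect_sym s_inj) x.
  have xr : fconnect s (froot s x) x.
    by rewrite fconnect_sym // connect_root.
  have lt_i : findex s (froot s x) x < n by rewrite -(os (froot s x)) findex_max.
  exists (enum_rank_in rx (froot s x), Ordinal lt_i).
  by rewrite /psi /= enum_rankK_in // iter_findex.
have [phi phiP] := fin_all_exists psi_surj.
have phiK : cancel psi phi by move=> u; apply: psi_inj; rewrite phiP.
exists phi; split; first by exists psi.
have adj_psi u v : adj (psi u) (psi v) = adj u v.
  rewrite copies_adjE (proj2 or_s) -!(inj_eq psi_inj).
  have iter_mod a y : iter (a %% n) s y = iter a s y.
    by rewrite -(os y) iter_mod_order.
  by rewrite /psi /= !iter_mod.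
by move=> x y; rewrite -adj_psi !phiP.
Qed.

End CopiesOfCycles.

Theorem theorem5 (k : nat) (G : sgraph) :
  0 < k -> 0 < #|G| -> regular 2 G -> k <= max_component_diameter G ->
  (distance_magic (pred1 k) G <->
   exists m : nat, 0 < m /\ isomorphic G (disjoint_copies m (cycle_graph (4 * k)))).
Proof.
move=> k_gt0 G_gt0 regG lek; have gt1_4k : 1 < 4 * k by lia.
split=> [magicG | [m [_ isoG]]]; last first.
  have [s or_s os] := orientation_of_copies gt1_4k isoG.
  have s_inj := proj1 or_s.
  pose t := iter k.*2 s.
  have tK : involutive t.
    move=> x; rewrite /t -iterD -{2}(iter_order s_inj x) os; congr iter; lia.
  have t_neq x : t x <> x.
    move/eqP; rewrite -[X in _ == X]/(iter 0 s x) eq_iter_mod // os !modn_small; lia.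
  have [f f_lab fE] := antipodal_labeling tK t_neq.
  exists f; split=> //; exists #|G|.+1 => x.
  have [y <-] : exists y, iter k s y = x.
    (* s^3k is the inverse of s^k *)
    exists (iter (3 * k) s x).
    by rewrite -iterD -[RHS](iter_order s_inj) os; congr iter; lia.
  rewrite (sphere_sum or_s) // os ifF ?ifF ?fE //; lia.
have [s or_s] := orientation_exists regG.
have os x : order s x = 4 * k by apply: magic_order; rewrite ?k_gt0.
exists #|froots s|; split; last exact: copies_of_orientation.
have [x _] := card_gt0P G_gt0.
by apply/card_gt0P; exists (froot s x); apply: (roots_root (fconnect_sym (proj1 or_s))).
Qed.
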